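(* Let $C=(C_\bullet,d,s,t)$ be an $H$-unital para-precyclic $k$-module and assume that $k\supset\mathbb Q$. Then, for every cocycle $\phi=(\phi_m,\phi_{m-2},\ldots)\in C^m_{T,\natural}$, $m\ge0$, the cyclic cochain $$\bar\nu_\natural(\phi)=\sum_{m-2j\ge0}(-1)^j\,\phi_{m-2j}\circ\left\{[1-(1-\tau)s'\hat Db](\hat b'\hat Db)^j\hat N\right\}\in C^m_\lambda$$ is a cocycle in the same cohomology class as $\phi$ (i.e. $(\bar\nu_\natural(\phi),0,\ldots)$ and $\phi$ are cohomologous in $(C^\bullet_{T,\natural},b+B)$).
   Context: $k$ is a unital ring, not assumed commutative; $k$-modules are left modules, and $\operatorname{Hom}_k(C_m,k)$ is regarded as a right $k$-module. A para-precyclic $k$-module consists of $k$-modules $C_m$, $m\ge0$, face maps $d_j:C_m\to C_{m-1}$ ($0\le j\le m$) with $d_id_j=d_{j-1}d_i$ for $i<j$, and an invertible $k$-linear map $t:C_\bullet\to C_\bullet$ of degree $0$ with $td_i=d_{i+1}t$ for $0\le i\le m-1$ and $d_m=d_0t$ on $C_m$ (notation: $d=d_m$ on $C_m$). Put $T=t^{m+1}$ on $C_m$; it commutes with $d$ and $t$. Let $b=\sum_{j=0}^m(-1)^jd_j$, $b'=\sum_{j=0}^{m-1}(-1)^jd_j$, $\tau=(-1)^mt$, $N=1+\tau+\cdots+\tau^m$ on $C_m$. It is $H$-unital, written $(C_\bullet,d,s,t)$, when equipped with a $k$-linear map $s:C_\bullet\to C_{\bullet+1}$ commuting with $T$ with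 $b's+sb'=1$. Put $s'=sb's$ and $B=(1-\tau)s'N:C_\bullet\to C_{\bullet+1}$. On $C_m$: $\hat Nx=(m+1)^{-1}Nx$, $\hat Dx=(m+1)^{-1}\sum_{j=0}^m(m-j)\tau^jx$, and $\hat b'x=m^{-1}b'x$ (with $\hat b'x=0$ if $m=0$). Cochains: $C_T^m=\{\phi\in\operatorname{Hom}_k(C_m,k):\phi\circ T=\phi\}$, with $b\phi=\phi\circ b\in C_T^{m+1}$ and $B\phi=\phi\circ B\in C_T^{m-1}$. $C^m_{T,\natural}=C_T^m\oplus C_T^{m-2}\oplus\cdots$, and $(C^\bullet_{T,\natural},b+B)$ is a cochain complex. $C_\lambda^m=\{\phi\in\operatorname{Hom}_k(C_m,k):\phi\circ\tau=\phi\}$ (cyclic cochains), and $(C^\bullet_\lambda,b)$ is Connes' cochain complex, included in $C^\bullet_{T,\natural}$ by $\phi\mapsto(\phi,0,\ldots)$. *)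

(* Defs.v *)
From HB Require Import structures.
From mathcomp Require Import all_boot all_order all_algebra.

Set Implicit Arguments.
Unset Strict Implicit.
Unset Printing Implicit Defensive.

Import GRing.Theory.
Local Open Scope ring_scope.

(* Degrees are natural numbers and the module in degree -1 is zero, so faces
   are only recorded on C m.+1.  The face d_j on C m.+1 is [face m j]; only the
   values with j <= m.+1 are constrained or used. *)
Record para_precyclic (k : nzRingType) := ParaPrecyclic {
  pp_mod :> nat -> lmodType k;
  face : forall m : nat, nat -> {linear pp_mod m.+1 -> pp_mod m};
  tmap : forall m : nat, {linear pp_mod m -> pp_mod m};
  tmap_bij : forall m, bijective (tmap m);
  face_face : forall m i j (x : pp_mod m.+2), (i < j)%N -> (j <= m.+2)%N ->
    face m i (face m.+1 j x) = face m j.-1 (face m.+1 i x);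
  tmap_face : forall m i (x : pp_mod m.+1), (i <= m)%N ->
    tmap m (face m i x) = face m i.+1 (tmap m.+1 x);
  face_last : forall m (x : pp_mod m.+1),
    face m m.+1 x = face m 0 (tmap m.+1 x)
}.

Section Operators.
Variables (k : nzRingType) (C : para_precyclic k).

Definition Tmap m (x : C m) : C m := iter m.+1 (tmap C m) x.

Definition tau m (x : C m) : C m := (-1) ^+ m *: tmap C m x.

Definition Nmap m (x : C m) : C m := \sum_(j < m.+1) iter j (@tau m) x.

(* Since 0.-1 = 0, the maps below send C 0 to itself; they are 0 there,
   which encodes C_{-1} = 0. *)
Definition bmap m : C m -> C m.-1 :=
  match m with
  | 0 => fun=> 0
  | p.+1 => fun x => \sum_(j < p.+2) (-1) ^+ j *: face C p j x
  end.

Definition b'map m : C m -> C m.-1 :=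
  match m with
  | 0 => fun=> 0
  | p.+1 => fun x => \sum_(j < p.+1) (-1) ^+ j *: face C p j x
  end.

End Operators.

(* The identity b' s + s b' = 1 is split according to the degree because s b'
   lands in C m.-1.+1; it vanishes in degree 0. *)
Record H_unital (k : nzRingType) := HUnital {
  hu_pp :> para_precyclic k;
  smap : forall m : nat, {linear hu_pp m -> hu_pp m.+1};
  smap_T : forall m (x : hu_pp m), smap m (Tmap x) = Tmap (smap m x);
  homotopy0 : forall x : hu_pp 0, b'map (smap 0 x) = x;
  homotopyS : forall m (x : hu_pp m.+1),
    b'map (smap m.+1 x) + smap m (b'map x) = x
}.

Section Cochains.
Variables (k : nzRingType) (C : H_unital k).

Definition s'map m (x : C m) : C m.+1 := smap C m (b'map (smap C m x)).

Definition Bmap m (x : C m) : C m.+1 :=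
  s'map (Nmap x) - tau (s'map (Nmap x)).

(* Hom_k(C m, k) is the set of linear maps into the regular left module k^o. *)
Definition T_cochain m (f : C m -> k^o) : Prop :=
  linear f /\ forall x, f (Tmap x) = f x.

Definition cyclic_cochain m (f : C m -> k^o) : Prop :=
  linear f /\ forall x, f (tau x) = f x.

Definition cyclic_cocycle m (f : C m -> k^o) : Prop :=
  cyclic_cochain f /\ forall x : C m.+1, f (bmap x) = 0.

(* An element (f_m, f_{m-2}, ...) of the total cochain module in degree m is a
   family indexed by all degrees, zero outside the degrees m, m-2, ... *)
Definition total_cochain m (f : forall n, C n -> k^o) : Prop :=
  forall n, if (n <= m)%N && (odd n == odd m) then T_cochain (f n)
            else forall x, f n x = 0.

(* Component in degree n of (b + B) f.  For n = 0 the first term is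
   f 0 0 = 0. *)
Definition total_diff (f : forall n, C n -> k^o) n (x : C n) : k^o :=
  f n.-1 (bmap x) + f n.+1 (Bmap x).

Definition total_cocycle m (f : forall n, C n -> k^o) : Prop :=
  total_cochain m f /\ forall n (x : C n), total_diff f x = 0.

Definition cohomologous m (f g : forall n, C n -> k^o) : Prop :=
  match m with
  | 0 => forall n (x : C n), f n x = g n x
  | p.+1 => exists h : forall n, C n -> k^o, total_cochain p h /\
              forall n (x : C n), f n x - g n x = total_diff h x
  end.

(* f |-> (f, 0, ...) *)
Definition cyclic_incl m (f : C m -> k^o) : forall n, C n -> k^o :=
  dfwith (fun n (_ : C n) => 0 : k^o) f.

(* The ring k contains the rationals through the (unique, injective)
   morphism iota. *)
Variable iota : {rmorphism rat -> k}.

Definition Nhat m (x : C m) : C m := iota (m.+1%:R^-1) *: Nmap x.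

Definition Dhat m (x : C m) : C m :=
  iota (m.+1%:R^-1) *: \sum_(j < m.+1) (iter j (@tau k C m) x *+ (m - j)).

(* In degree 0 this is 0, as b'map is. *)
Definition b'hat m (x : C m) : C m.-1 := iota (m%:R^-1) *: b'map x.

Definition b'Db m (x : C m) : C m.-2 := b'hat (Dhat (bmap x)).

Lemma iter_pred2 j m : iter j (fun n => n.-2) m = (m - j.*2)%N.
Proof.
by elim: j => [|j IHj]; rewrite ?subn0 //= IHj doubleS !subnS.
Qed.

(* The j-th power of b'Db on C m; its target degree is m - 2j. *)
Fixpoint b'Db_pow j m (x : C m) : C (iter j (fun n => n.-2) m) :=
  match j with
  | 0 => x
  | i.+1 => b'Db (b'Db_pow i x)
  end.

(* 1 - (1 - tau) s' Dhat b, where b = 0 in degree 0. *)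
Definition correction m : C m -> C m :=
  match m with
  | 0 => id
  | p.+1 => fun x : C p.+1 =>
      let y := s'map (Dhat (bmap x)) in x - (y - tau y)
  end.

Definition nu_natural m (f : forall n, C n -> k^o) (x : C m) : k^o :=
  \sum_(j < (m./2).+1)
    (-1) ^+ j *: f _ (correction (b'Db_pow j (Nhat x))).

End Cochains.

(* Main.v *)
Require Import Defs.
From HB Require Import structures.
From mathcomp Require Import all_boot all_order all_algebra.

Set Implicit Arguments.
Unset Strict Implicit.
Unset Printing Implicit Defensive.

Import GRing.Theory.
Local Open Scope ring_scope.

(** Everything rests on exact operator identities on the modules C_n; that phi
    is T-invariant enters only to make nu cyclic and to keep the cochains built
    from phi T-invariant.
    Write W = 1 - tau, K = W s' D^, F = 1 - K b, E = b'^ D^ and A = E b, so that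
    nu is the sum over j of (-1)^j phi_(m - 2j) F A^j N^.  The standard relations
    b W = W b', N b = b' N, N W = 1 - T and b^2 = b'^2 = 0, the facts that s' is
    again a contracting homotopy for b' with s' s' = 0 and commutes with T, and
    the key property D^ W = W D^ = 1 - N^ give

      1 - F N^ = b K + K b + B E                              on C_n, n > 0,
      A N^     = E b + N^ b E                                 on C_n, n > 1,
      E B      = N^ - s' N b / (n + 1) - N^ b s' N / (n + 2)  on C_n,
      K B      = - B s' N / (n + 2)                           on C_n,
      B K = 0,  s' N B = 0

    (correction_Nhat, b'Db_Nhat, Emap_Bmap0 and Emap_BmapS, Kmap_Bmap, Bmap_Kmap,
    s'_N_Bmap).

    For a cocycle phi, put Phi_n = sum over j of (-1)^j phi_(n - 2j) F A^j for
    every n, so that Phi_(n+2) = phi_(n+2) F - Phi_n A and nu = Phi_m N^.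
    Since phi b = - phi B, the first two identities yield by induction on n

      phi_n - Phi_n N^ = g_(n-1) b,   g_n = phi_(n+1) K + Phi_(n-1) E,

    (phi_sub_pre_nu_Nhat) and hence Phi_n N^ b = phi_n b.  For n = m this is the
    cocycle condition of nu, because phi_m b = - phi_(m+2) B = 0.  The other
    identities give

      g_(n+1) B = phi_n - h_(n-1) b,  h_n = g_n + Phi_(n+1) s' N / (n + 2),

    (top_primitive_Bmap) and (h_n - g_n) B = 0.  Therefore the cochain with
    component g in degree m - 1 and h in the degrees m - 3, m - 5, ... has
    coboundary phi - nu. *)

(** * Finite sums *)

Section Sums.
Variable V : zmodType.

(** Summation by parts; applied to u_j = tau^j x it says W D = (m + 1) - N. *)
Lemma sum_weighted_telescope (u : nat -> V) m :
  \sum_(j < m.+1) ((u j - u j.+1) *+ (m - j)) = u 0 *+ m.+1 - \sum_(j < m.+1) u j.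
Proof.
elim: m => [|m IHm]; first by rewrite !big_ord1 mulr1n subrr.
rewrite big_ord_recr /= subnn mulr0n addr0.
have -> : \sum_(j < m.+1) ((u j - u j.+1) *+ (m.+1 - j)) =
    \sum_(j < m.+1) ((u j - u j.+1) *+ (m - j)) + \sum_(j < m.+1) (u j - u j.+1).
  rewrite -big_split; apply: eq_bigr => j _ /=.
  by rewrite subSn 1?mulrSr // -ltnS.
have -> : \sum_(j < m.+1) (u j - u j.+1) = u 0 - u m.+1.
  rewrite -(big_mkord predT (fun j => u j - u j.+1)) -opprB.
  rewrite -(telescope_sumr u (leq0n m.+1)) -sumrN.
  by apply: eq_bigr => j _; rewrite opprB.
by rewrite IHm [in RHS]big_ord_recr /= (mulrSr _ m.+1) opprD addrACA.
Qed.

(** The weights select u_0, ..., u_i from the first summand and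
    u_(i+1), ..., u_(p+1) from the second one.  In the proof of N b = b' N, u_j
    is the i-th signed face of tau^j x, and l is the exponent of tau in N. *)
Lemma sum_overlap (u : nat -> V) i p : (i <= p)%N ->
  \sum_(l < p.+1) (u l *+ (l <= i)%N + u l.+1 *+ (i <= l)%N) = \sum_(j < p.+2) u j.
Proof.
move=> le_ip; rewrite big_split /= -!(big_mkord predT).
rewrite -(big_mkord predT (fun l => u l *+ (l <= i)%N)).
rewrite -(big_mkord predT (fun l => u l.+1 *+ (i <= l)%N)).
have -> : \sum_(0 <= l < p.+1) u l *+ (l <= i)%N = \sum_(0 <= l < i.+1) u l.
  rewrite (big_cat_nat (n := i.+1)) //= [X in _ + X = _]big_nat.
  rewrite [X in _ + X = _]big1 ?addr0 => [|j /andP[lt_ij _]]; last first.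
    by rewrite leqNgt lt_ij.
  by rewrite big_nat [RHS]big_nat; apply: eq_bigr => j /andP[_]; rewrite ltnS => ->.
have -> : \sum_(0 <= l < p.+1) u l.+1 *+ (i <= l)%N = \sum_(i <= l < p.+1) u l.+1.
  rewrite (big_cat_nat (n := i)) //=; last exact: leqW.
  rewrite [X in X + _ = _]big_nat [X in X + _ = _]big1 ?add0r => [|j /andP[_ lt_ji]].
    by rewrite big_nat [RHS]big_nat; apply: eq_bigr => j /andP[->].
  by rewrite leqNgt lt_ji.
by rewrite [in RHS](big_cat_nat (n := i.+1)) ?big_add1 //= ltnS leqW.
Qed.

Lemma sum_shift (u : nat -> V) n :
  u 0 + \sum_(i < n) u i.+1 = \sum_(i < n) u i + u n.
Proof.
have := big_ord_recr (idx := 0) (op := +%R) n (fun i : 'I_n.+1 => u i).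
by rewrite big_ord_recl.
Qed.

End Sums.

(** * Identities in a para-precyclic module *)

(* Unfolded to sums, these operators would be split by the additivity lemmas. *)
Local Arguments bmap : simpl never.
Local Arguments b'map : simpl never.

Section Precyclic.
Variables (k : nzRingType) (C : para_precyclic k).

Lemma signZ_linear (U V : lmodType k) n (f : {linear U -> V}) :
  linear (fun x => (-1) ^+ n *: f x).
Proof.
move=> a x y; rewrite -signr_odd linearP.
by case: odd; rewrite ?scale1r // !scaleN1r opprD scalerN.
Qed.

Lemma sum_linear (U V : lmodType k) n (f : 'I_n -> U -> V) :
  (forall i, linear (f i)) -> linear (fun x => \sum_(i < n) f i x).
Proof.
move=> fL a x y /=; rewrite scaler_sumr -big_split; apply: eq_bigr => i _.
exact: fL.
Qed.

Lemma sub_linear (U V : lmodType k) (f g : U -> V) :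
  linear f -> linear g -> linear (fun x => f x - g x).
Proof. by move=> fL gL a x y; rewrite fL gL opprD addrACA scalerBr. Qed.

Lemma iter_linear (U : lmodType k) n (f : U -> U) : linear f -> linear (iter n f).
Proof. by move=> fL a x y; elim: n => //= n ->; rewrite fL. Qed.

Lemma tau_linear m : linear (@tau k C m).
Proof. exact: signZ_linear. Qed.
HB.instance Definition _ m :=
  GRing.isLinear.Build k (C m) (C m) _ (@tau k C m) (@tau_linear m).

Lemma Nmap_linear m : linear (@Nmap k C m).
Proof. by apply: sum_linear => i; apply/iter_linear/tau_linear. Qed.
HB.instance Definition _ m :=
  GRing.isLinear.Build k (C m) (C m) _ (@Nmap k C m) (@Nmap_linear m).

Lemma zero_linear (U V : lmodType k) : linear (fun _ : U => 0 : V).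
Proof. by move=> a x y; rewrite scaler0 addr0. Qed.

Lemma bmap_linear m : linear (@bmap k C m).
Proof.
by case: m => [|m]; [exact: zero_linear|apply: sum_linear => i; exact: signZ_linear].
Qed.
HB.instance Definition _ m :=
  GRing.isLinear.Build k (C m) (C m.-1) _ (@bmap k C m) (@bmap_linear m).

Lemma b'map_linear m : linear (@b'map k C m).
Proof.
by case: m => [|m]; [exact: zero_linear|apply: sum_linear => i; exact: signZ_linear].
Qed.
HB.instance Definition _ m :=
  GRing.isLinear.Build k (C m) (C m.-1) _ (@b'map k C m) (@b'map_linear m).

(** With the sign absorbed, conjugation by tau shifts the index of a face with
    no sign left. *)
Definition sface m j (x : C m.+1) : C m := (-1) ^+ j *: face C m j x.

Lemma sface_linear m j : linear (@sface m j).
Proof. exact: signZ_linear. Qed.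
HB.instance Definition _ m j :=
  GRing.isLinear.Build k (C m.+1) (C m) _ (@sface m j) (@sface_linear m j).

Lemma tau_sface m i (x : C m.+1) : (i <= m)%N ->
  tau (sface i x) = sface i.+1 (tau x).
Proof.
move=> le_im; rewrite /tau /sface !linearZ_LR /= tmap_face // !scalerA -!exprD.
by rewrite addSn addnS !exprS !mulN1r opprK addnC.
Qed.

Lemma sface_last m (x : C m.+1) : sface m.+1 x = sface 0 (tau x).
Proof. by rewrite /sface /tau expr0 scale1r linearZ_LR /= face_last. Qed.

Lemma bmap_split p (x : C p.+1) : bmap x = b'map x + sface p.+1 x.
Proof. exact: big_ord_recr. Qed.

Lemma bmap_sub_tau p (x : C p.+1) :
  bmap (x - tau x) = b'map x - tau (b'map x).
Proof.
rewrite linearB /= [bmap x]bmap_split -addrA; congr (_ + _).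
suff -> : bmap (tau x) = tau (b'map x) + sface p.+1 x by rewrite opprD addrC subrK.
rewrite [LHS]big_ord_recl /= addrC sface_last; congr (_ + _).
rewrite raddf_sum; apply: eq_bigr => i _.
by rewrite [RHS](tau_sface (i := i)) // -ltnS.
Qed.

(** Moving tau^l to the right raises the index of each signed face by l.  The
    faces whose index would exceed p wrap around to the indices 0, ..., l, and
    the wrap costs one more tau because the last face is d_0 tau.  No inverse of
    tau is used, so that T does not appear. *)
Lemma iter_tau_b p l (x : C p.+1) : (l <= p)%N ->
  iter l (@tau k C p) (bmap x) =
  \sum_(i < p.+1) (sface i (iter l (@tau k C p.+1) x) *+ (l <= i)%N +
                   sface i (iter l.+1 (@tau k C p.+1) x) *+ (i <= l)%N).
Proof.
elim: l => [_|l IHl lt_lp].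
  rewrite bmap_split sface_last big_split /=; congr (_ + _).
  by rewrite big_ord_recl /= big1 ?addr0.
rewrite iterS {}IHl 1?ltnW // raddf_sum /=.
set y := iter l _ x; set z := tau y.
rewrite (eq_bigr (fun i : 'I_p.+1 =>
  sface i.+1 z *+ (l.+1 <= i.+1)%N + sface i.+1 (tau z) *+ (i.+1 <= l.+1)%N)).
  rewrite big_split [RHS]big_split /=.
  have := sum_shift (fun i => sface i z *+ (l.+1 <= i)%N) p.+1.
  have := sum_shift (fun i => sface i (tau z) *+ (i <= l.+1)%N) p.+1.
  rewrite /= mulr0n add0r (ltnS l p) (ltnW lt_lp) (ltnS p l) (leqNgt p) lt_lp /= addr0.
  by move=> <- ->; rewrite sface_last addrA.
by move=> i _; rewrite raddfD /= !raddfMn /= !tau_sface // -ltnS.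
Qed.

Lemma N_b p (x : C p.+1) : Nmap (bmap x) = b'map (Nmap x).
Proof.
rewrite /Nmap; under eq_bigr => l _ do rewrite iter_tau_b -1?ltnS //.
rewrite exchange_big; apply: eq_bigr => i _ /=.
rewrite -[RHS]/(sface i _) raddf_sum.
apply: (sum_overlap (fun j => sface i (iter j (@tau k C p.+1) x))).
by rewrite -ltnS.
Qed.

(** Common source of b^2 = 0 and b'^2 = 0: raising q by one adds the pairs
    (i, q + 1) and (q, i) with i <= q, which cancel. *)
Lemma face_double_sum p q (x : C p.+2) : (q <= p.+2)%N ->
  \sum_(i < q) \sum_(j < q.+1) sface i (sface j x) = 0.
Proof.
elim: q => [_|q IHq ltqp]; first by rewrite big_ord0.
under eq_bigr do rewrite big_ord_recr /=.
rewrite big_split big_ord_recr /= IHq 1?ltnW // add0r -big_split big1 //= => i _.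
rewrite /sface !linearZ_LR /= (face_face _ (ltn_ord i)) //= !scalerA -!exprD.
by rewrite addnS addnC exprS mulN1r scaleNr subrr.
Qed.

Lemma b_b p (x : C p.+2) : bmap (bmap x) = 0.
Proof.
rewrite -[RHS](face_double_sum x (leqnn _)); apply: eq_bigr => i _.
by rewrite -[LHS]/(sface i _) /bmap raddf_sum.
Qed.

Lemma b'_b' p (x : C p.+2) : b'map (b'map x) = 0.
Proof.
rewrite -[RHS](face_double_sum x (leqnSn _)); apply: eq_bigr => i _.
by rewrite -[LHS]/(sface i _) /b'map raddf_sum.
Qed.

Lemma iter_tau m j (x : C m) :
  iter j (@tau k C m) x = (-1) ^+ (m * j) *: iter j (tmap C m) x.
Proof.
elim: j => [|j IHj] /=; first by rewrite muln0 scale1r.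
by rewrite IHj /tau linearZ_LR /= scalerA -exprD mulnS.
Qed.

(** The sign is (-1)^(m(m+1)) = 1. *)
Lemma iter_tau_T m (x : C m) : iter m.+1 (@tau k C m) x = Tmap x.
Proof. by rewrite iter_tau -signr_odd oddM oddS andbN scale1r. Qed.

Lemma Nmap_sub_tau m (x : C m) : Nmap (x - tau x) = x - Tmap x.
Proof.
rewrite linearB /= -iter_tau_T /Nmap.
under [X in _ - X]eq_bigr do rewrite -iterSr.
apply/eqP; rewrite subr_eq addrAC -subr_eq opprK.
by rewrite -(sum_shift (fun j => iter j (@tau k C m) x)).
Qed.

Lemma tau_T m (x : C m) : tau (Tmap x) = Tmap (tau x).
Proof. by rewrite -!iter_tau_T -iterS iterSr. Qed.

Lemma Tmap_linear m : linear (@Tmap k C m).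
Proof. by apply/iter_linear; exact: linearP. Qed.
HB.instance Definition _ m :=
  GRing.isLinear.Build k (C m) (C m) _ (@Tmap k C m) (@Tmap_linear m).

Lemma iter_tmap_face m i l (x : C m.+1) : (i + l <= m.+1)%N ->
  iter l (tmap C m) (face C m i x) = face C m (i + l) (iter l (tmap C m.+1) x).
Proof.
elim: l => [|l IHl] le_il /=; first by rewrite addn0.
by rewrite IHl 1?ltnW ?tmap_face ?addnS // -ltnS -addnS.
Qed.

(** Every t raises the index of the face by one.  After m + 1 - i of them the
    last face is reached, where the index restarts at 0 at the cost of one more
    t; the remaining i bring it back to i. *)
Lemma face_T m i (x : C m.+1) : (i <= m.+1)%N ->
  face C m i (Tmap x) = Tmap (face C m i x).
Proof.
move=> le_im; rewrite /Tmap.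
have -> : iter m.+1 (tmap C m) (face C m i x) =
    iter i (tmap C m) (iter (m.+1 - i) (tmap C m) (face C m i x)).
  by rewrite -iterD subnKC.
rewrite iter_tmap_face subnKC // face_last iter_tmap_face // add0n.
by rewrite -iterS -iterD addnS subnKC.
Qed.

Definition T_equivariant m n (L : C m -> C n) := forall x, L (Tmap x) = Tmap (L x).

Lemma N_T m : T_equivariant (@Nmap k C m).
Proof.
move=> x; rewrite [RHS]raddf_sum; apply: eq_bigr => j _ /=.
by elim: (j : nat) => //= i ->; rewrite tau_T.
Qed.

Lemma signed_face_sum_T m q : (q <= m.+2)%N ->
  T_equivariant (fun x : C m.+1 => \sum_(j < q) (-1) ^+ j *: face C m j x).
Proof.
move=> le_qm x; rewrite raddf_sum; apply: eq_bigr => j _.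
by rewrite [RHS]linearZ_LR /= face_T // -ltnS (leq_trans _ le_qm).
Qed.

Lemma b_T m : T_equivariant (@bmap k C m).
Proof. by case: m => [|m] x; [rewrite linear0 | exact: signed_face_sum_T]. Qed.

Lemma b'_T m : T_equivariant (@b'map k C m).
Proof. by case: m => [|m] x; [rewrite linear0 | exact: signed_face_sum_T]. Qed.

End Precyclic.

(** * Rational scalars in a noncommutative ring *)

Section RationalScalars.
Variables (k : nzRingType) (iota : {rmorphism rat -> k}).

Lemma iota_natVK n : iota n.+1%:R^-1 * n.+1%:R = 1.
Proof. by rewrite -(rmorph_nat iota) -rmorphM mulVf ?rmorph1 // Num.Theory.pnatr_eq0. Qed.

(** Inverses of integers are central because integers are; this makes
    multiplication by them linear although [k] is not commutative. *)
Lemma iota_natV_comm n a : iota n%:R^-1 * a = a * iota n%:R^-1.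
Proof.
case: n => [|n]; first by rewrite invr0 rmorph0 mul0r mulr0.
have c_n : n.+1%:R * iota n.+1%:R^-1 = 1 by rewrite -commr_nat iota_natVK.
by rewrite -[LHS]mulr1 -c_n mulrA -(mulrA _ a) commr_nat !mulrA iota_natVK mul1r.
Qed.

Lemma iota_natV_linear (U V : lmodType k) n (f : U -> V) :
  linear f -> linear (fun x => iota n%:R^-1 *: f x).
Proof. by move=> fL a x y; rewrite fL scalerDr !scalerA iota_natV_comm. Qed.

Lemma iota_natV_mulrn (V : lmodType k) n (x : V) :
  iota n.+1%:R^-1 *: (x *+ n.+1) = x.
Proof. by rewrite -scaler_nat scalerA iota_natVK scale1r. Qed.

End RationalScalars.

(** * The homotopies s', D^ and the operators built from them *)

Section Homotopy.
Variables (k : nzRingType) (C : H_unital k).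

Lemma s'map_linear m : linear (@s'map k C m).
Proof. by move=> a x y; rewrite /s'map !linearP. Qed.
HB.instance Definition _ m :=
  GRing.isLinear.Build k (C m) (C m.+1) _ (@s'map k C m) (@s'map_linear m).

Lemma s'_T m : T_equivariant (@s'map k C m).
Proof. by move=> x; rewrite /s'map smap_T b'_T smap_T. Qed.

(** The composite b's is the identity on the image of b', so that s' inherits
    the homotopy identity from s and moreover squares to zero. *)
Lemma b'_s_b' p (x : C p.+1) : b'map (smap C p (b'map x)) = b'map x.
Proof.
case: p x => [|p] x; first exact: homotopy0.
by apply/eqP; rewrite -subr_eq0 -{2}(homotopyS (b'map x)) b'_b' linear0 addr0 subrr.
Qed.

Lemma homotopy'0 (x : C 0) : b'map (s'map x) = x.
Proof. by rewrite /s'map b'_s_b' homotopy0. Qed.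

Lemma homotopy'S p (x : C p.+1) : b'map (s'map x) + s'map (b'map x) = x.
Proof. by rewrite /s'map !b'_s_b' homotopyS. Qed.

(** With y = b's x one has b's y = y, so the homotopy identity at s y reads
    b's s y = 0. *)
Lemma s'_s' m (x : C m) : s'map (s'map x) = 0.
Proof.
rewrite {1}/s'map /s'map; set y := b'map (smap C m x).
have := homotopyS (smap C m y); rewrite b'_s_b' -/y => /(canRL (addrK _)) ->.
by rewrite subrr linear0.
Qed.

Definition one_sub_tau m (x : C m) := x - tau x.

Lemma one_sub_tau_linear m : linear (@one_sub_tau m).
Proof. by apply: sub_linear => a x y; rewrite ?linearP. Qed.
HB.instance Definition _ m :=
  GRing.isLinear.Build k (C m) (C m) _ (@one_sub_tau m) (@one_sub_tau_linear m).

Lemma one_sub_tau_T m : T_equivariant (@one_sub_tau m).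
Proof. by move=> x; rewrite /one_sub_tau tau_T linearB. Qed.

Lemma b_one_sub_tau p (x : C p.+1) :
  bmap (one_sub_tau x) = one_sub_tau (b'map x).
Proof. exact: bmap_sub_tau. Qed.

(** N W = 1 - T commutes with s', and s' s' = 0. *)
Lemma s'_N_one_sub_tau_s' m (x : C m) :
  s'map (Nmap (one_sub_tau (s'map x))) = 0.
Proof. by rewrite Nmap_sub_tau linearB /= s'_T s'_s' linear0 subr0. Qed.

Variable iota : {rmorphism rat -> k}.

Lemma Nhat_linear m : linear (@Nhat k C iota m).
Proof. exact/iota_natV_linear/linearP. Qed.
HB.instance Definition _ m :=
  GRing.isLinear.Build k (C m) (C m) _ (@Nhat k C iota m) (@Nhat_linear m).

Lemma Dhat_linear m : linear (@Dhat k C iota m).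
Proof.
apply: iota_natV_linear; apply: sum_linear => j a x y.
by rewrite (iter_linear _ (@tau_linear _ _ m)) mulrnDl scalerMnr.
Qed.
HB.instance Definition _ m :=
  GRing.isLinear.Build k (C m) (C m) _ (@Dhat k C iota m) (@Dhat_linear m).

Lemma b'hat_linear m : linear (@b'hat k C iota m).
Proof. exact/iota_natV_linear/linearP. Qed.
HB.instance Definition _ m :=
  GRing.isLinear.Build k (C m) (C m.-1) _ (@b'hat k C iota m) (@b'hat_linear m).

Lemma Nhat_T m : T_equivariant (@Nhat k C iota m).
Proof. by move=> x; rewrite /Nhat N_T linearZ_LR. Qed.

Lemma Dhat_T m : T_equivariant (@Dhat k C iota m).
Proof.
move=> x; rewrite /Dhat linearZ_LR [X in _ = _ *: X]raddf_sum; congr (_ *: _).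
apply: eq_bigr => j _ /=; rewrite raddfMn /=; congr (_ *+ _).
by elim: (j : nat) => //= i ->; rewrite tau_T.
Qed.

Lemma b'hat_T m : T_equivariant (@b'hat k C iota m).
Proof. by move=> x; rewrite /b'hat b'_T linearZ_LR. Qed.

Lemma one_sub_tau_Dhat m (x : C m) : one_sub_tau (Dhat iota x) = x - Nhat iota x.
Proof.
have -> : x - Nhat iota x = iota m.+1%:R^-1 *: (x *+ m.+1 - Nmap x).
  by rewrite scalerBr iota_natV_mulrn.
rewrite /Dhat linearZ_LR [X in _ *: X = _]raddf_sum; congr (_ *: _).
rewrite -(sum_weighted_telescope (fun j => iter j (@tau k C m) x)).
by apply: eq_bigr => j _; rewrite /= raddfMn.
Qed.

Lemma Dhat_one_sub_tau m (x : C m) : Dhat iota (one_sub_tau x) = x - Nhat iota x.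
Proof.
rewrite -one_sub_tau_Dhat /Dhat linearZ_LR [X in _ = _ *: X]raddf_sum; congr (_ *: _).
apply: eq_bigr => j _; rewrite /= raddfMn /=; congr (_ *+ _).
by elim: (j : nat) => //= i ->; rewrite /one_sub_tau linearB.
Qed.

Lemma Dhat0 (x : C 0) : Dhat iota x = 0.
Proof. by rewrite /Dhat big_ord1 mulr0n scaler0. Qed.

Lemma Nhat0 (x : C 0) : Nhat iota x = x.
Proof. by rewrite /Nhat /Nmap big_ord1 /= invr1 rmorph1 scale1r. Qed.

Definition Emap m (x : C m) : C m.-1 := b'hat iota (Dhat iota x).

Lemma Emap_linear m : linear (@Emap m).
Proof. by move=> a x y; rewrite /Emap !linearP. Qed.
HB.instance Definition _ m :=
  GRing.isLinear.Build k (C m) (C m.-1) _ (@Emap m) (@Emap_linear m).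

Lemma Emap_T m : T_equivariant (@Emap m).
Proof. by move=> x; rewrite /Emap Dhat_T b'hat_T. Qed.

Definition Kmap m (x : C m) : C m.+1 := one_sub_tau (s'map (Dhat iota x)).

Lemma Kmap_linear m : linear (@Kmap m).
Proof. by move=> a x y; rewrite /Kmap !linearP. Qed.
HB.instance Definition _ m :=
  GRing.isLinear.Build k (C m) (C m.+1) _ (@Kmap m) (@Kmap_linear m).

Lemma Kmap_T m : T_equivariant (@Kmap m).
Proof. by move=> x; rewrite /Kmap Dhat_T s'_T one_sub_tau_T. Qed.

Lemma correctionS p (x : C p.+1) : correction iota x = x - Kmap (bmap x).
Proof. by []. Qed.

Lemma correction_linear m : linear (@correction k C iota m).
Proof.
case: m => [//|m]; apply: sub_linear => a x y //.
by rewrite -![_ - tau _]/(Kmap (bmap _)) !linearP.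
Qed.
HB.instance Definition _ m := GRing.isLinear.Build k (C m) (C m) _
  (@correction k C iota m) (@correction_linear m).

Lemma correction_T m : T_equivariant (@correction k C iota m).
Proof.
by case: m => [|m] x //; rewrite !correctionS b_T Kmap_T [RHS]linearB.
Qed.

Lemma b'Db_linear m : linear (@b'Db k C iota m).
Proof. by move=> a x y; rewrite /b'Db !linearP. Qed.
HB.instance Definition _ m := GRing.isLinear.Build k (C m) (C m.-2) _
  (@b'Db k C iota m) (@b'Db_linear m).

Lemma b'Db_T m : T_equivariant (@b'Db k C iota m).
Proof. by move=> x; rewrite /b'Db b_T Dhat_T b'hat_T. Qed.

Local Notation Nhat := (Nhat iota).
Local Notation Dhat := (Dhat iota).
Local Notation b'hat := (b'hat iota).
Local Notation b'Db := (b'Db iota).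
Local Notation correction := (correction iota).

(** Both sides are D^ b W D^ = D^ W b' D^. *)
Lemma Dhat_b_commutator p (x : C p.+1) :
  Dhat (bmap x) - Dhat (bmap (Nhat x)) = b'map (Dhat x) - Nhat (b'map (Dhat x)).
Proof.
by rewrite -Dhat_one_sub_tau -b_one_sub_tau one_sub_tau_Dhat !linearB.
Qed.

Lemma BmapE p (y : C p) : Bmap y = one_sub_tau (s'map (Nmap y)).
Proof. by []. Qed.

Lemma KmapE p (y : C p) : Kmap y = one_sub_tau (s'map (Dhat y)).
Proof. by []. Qed.

Lemma EmapE p (y : C p) : Emap y = b'hat (Dhat y).
Proof. by []. Qed.

Lemma b'DbE p (y : C p) : b'Db y = Emap (bmap y).
Proof. by []. Qed.

Lemma NhatE m (x : C m) : Nhat x = iota m.+1%:R^-1 *: Nmap x.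
Proof. by []. Qed.

Lemma b'hatE m (x : C m) : b'hat x = iota m%:R^-1 *: b'map x.
Proof. by []. Qed.

(** Start from 1 - N^ = W D^ = W (b's' + s'b') D^ = b K + W s' b' D^; the
    commutator of D^ with b turns W s' b' D^ + K b N^ into
    K b + W s' N^ b' D^ = K b + B E. *)
Lemma correction_Nhat p (x : C p.+1) :
  x - correction (Nhat x) = bmap (Kmap x) + Kmap (bmap x) + Bmap (Emap x).
Proof.
have split_x : x - Nhat x =
    bmap (Kmap x) + one_sub_tau (s'map (b'map (Dhat x))).
  rewrite -one_sub_tau_Dhat -{1}(homotopy'S (Dhat x)) [LHS]linearD /=.
  by rewrite -b_one_sub_tau -KmapE.
have commute_K : one_sub_tau (s'map (b'map (Dhat x))) + Kmap (bmap (Nhat x)) =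
    Kmap (bmap x) + @Bmap k C p (Emap x).
  have -> : @Bmap k C p (Emap x) = one_sub_tau (s'map (Nhat (b'map (Dhat x)))).
    by rewrite BmapE EmapE b'hatE NhatE !linearZ_LR.
  rewrite !KmapE -[LHS]linearD -[RHS]linearD /= -[in LHS]linearD -[in RHS]linearD.
  congr (one_sub_tau (s'map _)).
  have /(canRL (subrK _)) -> := Dhat_b_commutator x.
  by rewrite addrAC subrK addrC.
rewrite correctionS; move: (Kmap (bmap (Nhat x))) split_x commute_K.
move: (one_sub_tau _) (bmap (Kmap x)) (Kmap (bmap x)) (Bmap _) (Nhat x).
move=> w a b c n n' split_x commute_K.
by rewrite opprB addrCA split_x addrCA [n' + w]addrC commute_K addrA.
Qed.

(** Apply b'^ to the commutator of D^ with b, using b'^2 = 0 and b' N = N b. *)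
Lemma b'Db_Nhat p (x : C p.+2) :
  b'Db (Nhat x) = Emap (bmap x) + Nhat (bmap (Emap x)).
Proof.
have -> : Nhat (bmap (Emap x)) = b'hat (Nhat (b'map (Dhat x))).
  rewrite EmapE !b'hatE !NhatE !linearZ_LR /= N_b !scalerA.
  by rewrite iota_natV_comm.
have b'hat_b' : b'hat (b'map (Dhat x)) = 0 by rewrite b'hatE b'_b' scaler0.
rewrite b'DbE !EmapE -linearD; apply/eqP; rewrite -subr_eq0 -linearB /=.
have := Dhat_b_commutator x => /(canRL (subrK _)) ->.
move: (Dhat (bmap (Nhat x))) (Nhat (b'map (Dhat x))) => y n.
by rewrite [_ - n + y]addrAC subrK opprD addrCA subrr addr0 linearN /= b'hat_b' oppr0.
Qed.

Lemma Emap_Bmap n (x : C n) :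
  Emap (Bmap x) = iota n.+1%:R^-1 *: b'map (s'map (Nmap x))
                  - iota n.+2%:R^-1 *: Nhat (bmap (s'map (Nmap x))).
Proof.
rewrite EmapE BmapE Dhat_one_sub_tau linearB /= !b'hatE !NhatE N_b.
by rewrite [b'map (_ *: _)]linearZ_LR /= !scalerA iota_natV_comm.
Qed.

Lemma Emap_Bmap0 (x : C 0) :
  Emap (Bmap x) = Nhat x - iota 2%:R^-1 *: Nhat (bmap (s'map (Nmap x))).
Proof. by rewrite Emap_Bmap homotopy'0. Qed.

Lemma Emap_BmapS p (x : C p.+1) :
  Emap (Bmap x) = Nhat x - iota p.+2%:R^-1 *: s'map (Nmap (bmap x))
                  - iota p.+3%:R^-1 *: Nhat (bmap (s'map (Nmap x))).
Proof.
rewrite Emap_Bmap N_b NhatE -scalerBr; congr (_ *: _ - _).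
by rewrite -{2}(homotopy'S (Nmap x)) addrK.
Qed.

Lemma Kmap_Bmap n (x : C n) :
  Kmap (Bmap x) = - (iota n.+2%:R^-1 *: Bmap (s'map (Nmap x))).
Proof.
rewrite KmapE !BmapE Dhat_one_sub_tau [s'map (_ - _)]linearB /= s'_s' sub0r.
by rewrite linearN NhatE !linearZ_LR.
Qed.

Lemma Bmap_Kmap n (x : C n) : Bmap (Kmap x) = 0.
Proof. by rewrite BmapE KmapE s'_N_one_sub_tau_s' linear0. Qed.

Lemma s'_N_Bmap n (x : C n) : s'map (Nmap (Bmap x)) = 0.
Proof. by rewrite BmapE s'_N_one_sub_tau_s'. Qed.

End Homotopy.

(** * Cochains *)

Section Cochains.
Variables (k : nzRingType) (C : H_unital k).

Lemma T_cochain_comp m n (f : C n -> k^o) (L : {linear C m -> C n}) :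
  T_cochain f -> T_equivariant L -> T_cochain (fun x => f (L x)).
Proof. by move=> [fL fT] LT; split=> [a x y | x]; rewrite ?linearP ?fL // LT fT. Qed.

Lemma T_cochain0 n (f : C n -> k^o) : (forall x, f x = 0) -> T_cochain f.
Proof. by move=> f0; split=> [a x y | x]; rewrite !f0 // scaler0 addr0. Qed.

Lemma T_cochainD n (f g : C n -> k^o) :
  T_cochain f -> T_cochain g -> T_cochain (fun x => f x + g x).
Proof.
move=> [fL fT] [gL gT]; split=> [a x y | x]; last by rewrite fT gT.
by rewrite fL gL addrACA scalerDr.
Qed.

Lemma T_cochainN n (f : C n -> k^o) : T_cochain f -> T_cochain (fun x => - f x).
Proof. by move=> [fL fT]; split=> [a x y | x]; rewrite ?fT // fL opprD scalerN. Qed.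

Lemma T_cochain_raddf n (f : C n -> k^o) : T_cochain f ->
  [/\ f 0 = 0, {morph f : x / - x}, {morph f : x y / x + y}
    & forall a x, f (a *: x) = a *: f x].
Proof.
move=> [fL _].
have fD : {morph f : x y / x + y} by move=> x y; have := fL 1 x y; rewrite !scale1r.
have f0 : f 0 = 0 by apply: (addrI (f 0)); rewrite -fD !addr0.
split=> // [x|a x]; first by apply: (addrI (f x)); rewrite -fD !subrr.
by rewrite -[a *: x]addr0 fL f0 addr0.
Qed.

Variable iota : {rmorphism rat -> k}.
Local Notation Nhat := (Nhat iota).
Local Notation b'Db := (b'Db iota).
Local Notation correction := (correction iota).
Local Notation Emap := (Emap iota).
Local Notation Kmap := (Kmap iota).

Variables (m : nat) (phi : forall n, C n -> k^o).
Hypothesis phi_cocycle : total_cocycle m phi.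

Lemma cocycle_T n : T_cochain (phi (n := n)).
Proof. by have := phi_cocycle.1 n; case: ifP => // _; exact: T_cochain0. Qed.

Let phi0 n := let: And4 f0 _ _ _ := T_cochain_raddf (cocycle_T n) in f0.
Let phiN n := let: And4 _ fN _ _ := T_cochain_raddf (cocycle_T n) in fN.
Let phiD n := let: And4 _ _ fD _ := T_cochain_raddf (cocycle_T n) in fD.
Let phiZ n := let: And4 _ _ _ fZ := T_cochain_raddf (cocycle_T n) in fZ.

Lemma cocycle_B0 (x : C 0) : phi (Bmap x) = 0.
Proof. by have := phi_cocycle.2 0%N x; rewrite /total_diff /= phi0 add0r. Qed.

Lemma cocycle_b n (x : C n.+1) : phi (bmap x) = - phi (Bmap x).
Proof. by apply/eqP; rewrite -addr_eq0; apply/eqP/phi_cocycle.2. Qed.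

(** The sum defining nu, in every degree and before averaging by N^.  It is
    defined for all n because its properties are proved by induction on n. *)
Definition pre_nu n (x : C n) : k^o :=
  \sum_(j < (n./2).+1) (-1) ^+ j *: phi (correction (b'Db_pow iota j x)).

Lemma nu_naturalE (x : C m) : nu_natural iota phi x = pre_nu (Nhat x).
Proof. by []. Qed.

(** The two powers live in degrees that are equal but not convertible, hence
    the comparison as dependent pairs. *)
Lemma b'Db_powSr j n (x : C n) :
  existT (fun i => C i) _ (b'Db_pow iota j.+1 x) =
  existT (fun i => C i) _ (b'Db_pow iota j (b'Db x)).
Proof.
elim: j => [//|j IHj].
pose step (u : {i & C i}) := existT (fun i => C i) (tag u).-2 (b'Db (tagged u)).
exact: (congr1 step IHj).
Qed.

Lemma pre_nuSS n (x : C n.+2) : pre_nu x = phi (correction x) - pre_nu (b'Db x).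
Proof.
rewrite /pre_nu /= big_ord_recl scale1r; congr (_ + _).
rewrite -sumrN; apply: eq_bigr => j _; rewrite lift0 exprS mulN1r scaleNr.
congr (- (_ *: _)).
pose value (u : {i & C i}) := phi (correction (tagged u)).
exact: (congr1 value (b'Db_powSr j x)).
Qed.

Lemma pre_nu0 (x : C 0) : pre_nu x = phi x.
Proof. by rewrite /pre_nu big_ord1 scale1r. Qed.

Lemma pre_nu1 (x : C 1) : pre_nu x = phi (correction x).
Proof. by rewrite /pre_nu big_ord1 scale1r. Qed.

Lemma pre_nu_T n : T_cochain (@pre_nu n).
Proof.
elim/ltn_ind: n => [[|[|n]] IH].
- have [fL fT] := cocycle_T 0.
  by split=> [a x y|x]; rewrite !pre_nu0; [exact: fL | exact: fT].
- have [fL fT] := T_cochain_comp (cocycle_T 1) (@correction_T _ _ iota 1).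
  by split=> [a x y|x]; rewrite !pre_nu1; [exact: fL | exact: fT].
have [fL fT] := T_cochainD (T_cochain_comp (cocycle_T n.+2) (@correction_T _ _ iota n.+2))
  (T_cochainN (T_cochain_comp (IH n (leqnSn n.+1)) (@b'Db_T _ _ iota n.+2))).
by split=> [a x y|x]; rewrite !pre_nuSS; [exact: fL | exact: fT].
Qed.

Let pre_nuN n := let: And4 _ fN _ _ := T_cochain_raddf (pre_nu_T n) in fN.
Let pre_nuD n := let: And4 _ _ fD _ := T_cochain_raddf (pre_nu_T n) in fD.
Let pre_nuZ n := let: And4 _ _ _ fZ := T_cochain_raddf (pre_nu_T n) in fZ.

(** In degree m - 1 this cochain accounts for phi - nu in degree m. *)
Definition top_primitive n (x : C n) : k^o := phi (Kmap x) + pre_nu (Emap x).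

Lemma top_primitive_T n : T_cochain (@top_primitive n).
Proof.
apply: T_cochainD.
  by apply: T_cochain_comp (cocycle_T _) _; exact: Kmap_T.
by apply: T_cochain_comp (pre_nu_T _) _; exact: Emap_T.
Qed.

Lemma top_primitive_0 n : @top_primitive n 0 = 0.
Proof. by have [] := T_cochain_raddf (top_primitive_T n). Qed.

Lemma bmap_bmap n (x : C n.+1) : bmap (bmap x) = 0.
Proof. by case: n x => [|n] x //; exact: b_b. Qed.

Lemma cocycle_b_Kmap n (x : C n) : phi (bmap (Kmap x)) = 0.
Proof. by rewrite cocycle_b Bmap_Kmap phi0 oppr0. Qed.

Lemma phi_sub_correction_Nhat p (x : C p.+1) :
  phi x - phi (correction (Nhat x)) =
  phi (Kmap (bmap x)) + @phi p.+1 (Bmap (Emap x)).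
Proof.
rewrite -phiN -phiD correction_Nhat [LHS]phiD [X in X + _ = _]phiD.
by rewrite cocycle_b_Kmap add0r.
Qed.

(** Induction by steps of 2.  Pulling phi back along 1 - F N^ = b K + K b + B E
    leaves phi K b + phi B E, and A N^ = E b + N^ b E transforms the tail of
    the sum; by the induction hypothesis the tail contributes
    phi b E = - phi B E, and the two terms cancel. *)
Lemma phi_sub_pre_nu_Nhat n (x : C n) :
  phi x - pre_nu (Nhat x) = top_primitive (bmap x).
Proof.
elim/ltn_ind: n x => [[|[|n]] IH] x.
- by rewrite pre_nu0 Nhat0 subrr [bmap x]/(0) top_primitive_0.
- rewrite pre_nu1 phi_sub_correction_Nhat cocycle_B0 addr0 /top_primitive.
  by rewrite [in RHS]EmapE Dhat0 linear0 pre_nu0 phi0 addr0.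
have pre_nu_Nhat_b (y : C n.+1) : pre_nu (Nhat (bmap y)) = phi (bmap y).
  by apply/eqP; rewrite eq_sym -subr_eq0 IH // bmap_bmap top_primitive_0.
rewrite pre_nuSS b'Db_Nhat pre_nuD pre_nu_Nhat_b opprB addrCA phi_sub_correction_Nhat.
rewrite (cocycle_b (Emap x)) /top_primitive; move: (phi (Bmap _)) (phi (Kmap _)) => u v.
by rewrite [v + u]addrC addrA subrK addrC.
Qed.

Lemma pre_nu_Nhat_b n (y : C n.+1) : pre_nu (Nhat (bmap y)) = phi (bmap y).
Proof.
by apply/eqP; rewrite eq_sym -subr_eq0 phi_sub_pre_nu_Nhat bmap_bmap top_primitive_0.
Qed.

(** The term by which the primitive differs in the degrees below m - 1: there
    the whole of phi, not phi - nu, has to be a coboundary. *)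
Definition low_extra n (x : C n) : k^o :=
  iota n.+2%:R^-1 *: pre_nu (s'map (Nmap x)).

Lemma low_extra_T n : T_cochain (@low_extra n).
Proof.
have [fL fT] := T_cochain_comp (T_cochain_comp (pre_nu_T n.+1) (@s'_T _ C n)) (@N_T _ C n).
split=> [|x]; first exact: iota_natV_linear.
by congr (_ *: _); exact: fT.
Qed.

Definition low_primitive n (x : C n) : k^o := top_primitive x + low_extra x.

(** The term - phi B s'N / (n + 2) coming from K B cancels the term
    - Phi N^ b s'N / (n + 2) coming from E B, because phi B = - phi b and
    Phi N^ b = phi b. *)
Lemma top_primitive_Bmap n (x : C n) :
  top_primitive (Bmap x) = phi x - low_primitive (bmap x).
Proof.
rewrite /top_primitive Kmap_Bmap phiN phiZ.
have -> : phi x = pre_nu (Nhat x) + top_primitive (bmap x).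
  by rewrite -phi_sub_pre_nu_Nhat subrKC.
rewrite /low_primitive opprD addrA addrK.
have bs'N : phi (Bmap (s'map (Nmap x))) = - pre_nu (Nhat (bmap (s'map (Nmap x)))).
  by rewrite pre_nu_Nhat_b cocycle_b opprK.
case: n x bs'N => [|p] x bs'N.
  rewrite Emap_Bmap0 pre_nuD pre_nuN [pre_nu (iota 2%:R^-1 *: _)]pre_nuZ bs'N.
  rewrite scalerN opprK addrCA subrr addr0.
  have [low_extra_0 _ _ _] := T_cochain_raddf (low_extra_T 0).
  by rewrite [bmap x]/(0) low_extra_0 subr0.
rewrite Emap_BmapS !pre_nuD !pre_nuN [pre_nu (iota p.+2%:R^-1 *: s'map _)]pre_nuZ.
rewrite [pre_nu (iota p.+3%:R^-1 *: _)]pre_nuZ bs'N scalerN opprK.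
by rewrite [LHS]addrC subrK.
Qed.

Lemma low_extra_Bmap n (x : C n) : low_extra (Bmap x) = 0.
Proof.
have [pre_nu_0 _ _ _] := T_cochain_raddf (pre_nu_T n.+2).
by rewrite /low_extra s'_N_Bmap pre_nu_0 scaler0.
Qed.

Lemma low_primitive_T n : T_cochain (@low_primitive n).
Proof. exact: T_cochainD (top_primitive_T n) (low_extra_T n). Qed.

Lemma low_primitive_0 n : @low_primitive n 0 = 0.
Proof. by have [] := T_cochain_raddf (low_primitive_T n). Qed.

Lemma cocycle_out n (x : C n) : ~~ ((n <= m)%N && (odd n == odd m)) -> phi x = 0.
Proof. by move/negPf=> n_out; have := phi_cocycle.1 n; rewrite n_out. Qed.

(** The sign is that of nu - phi.  The parity condition is that of the degrees
    m - 1, m - 3, ... *)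
Definition primitive n (x : C n) : k^o :=
  if (n < m)%N && (odd n != odd m) then
    if n.+1 == m then - top_primitive x else - low_primitive x
  else 0.

Lemma primitive_T n : T_cochain (@primitive n).
Proof.
rewrite /primitive; case: (_ && _); last exact: T_cochain0.
by case: (_ == m); apply: T_cochainN; [exact: top_primitive_T | exact: low_primitive_T].
Qed.

Lemma primitive_bmap n (x : C n) : (n < m)%N -> odd n = odd m ->
  primitive (bmap x) = - low_primitive (bmap x).
Proof.
case: n x => [|n] x lt_nm odd_n.
  rewrite [bmap x]/(0) low_primitive_0 oppr0.
  by have [] := T_cochain_raddf (primitive_T 0).
by rewrite /primitive /= -odd_n oddS ltnW // ltn_eqF //; case: odd.
Qed.

Lemma primitive_Bmap n (x : C n) : (n < m)%N -> odd n = odd m ->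
  primitive (Bmap x) = - (phi x - low_primitive (bmap x)).
Proof.
move=> lt_nm odd_n; rewrite /primitive -top_primitive_Bmap.
have -> : low_primitive (Bmap x) = top_primitive (Bmap x).
  by rewrite [LHS]/low_primitive low_extra_Bmap addr0.
have neq_n1m : n.+1 != m by apply: contra_eq_neq odd_n => <- /=; case: odd.
by rewrite if_same ltn_neqAle neq_n1m lt_nm -odd_n oddS; case: odd.
Qed.

Lemma primitive_out n (x : C n) : (m <= n)%N || (odd n == odd m) -> primitive x = 0.
Proof. by rewrite /primitive ltnNge -negb_or => ->. Qed.

Lemma primitive_top (x : C m.-1) : (0 < m)%N -> primitive x = - top_primitive x.
Proof.
move=> m_gt0; have odd_m : odd m = ~~ odd m.-1 by rewrite -oddS prednK.
by rewrite /primitive prednK // leqnn eqxx odd_m; case: odd.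
Qed.

Lemma primitive_cochain p : m = p.+1 -> total_cochain p primitive.
Proof.
move=> def_m n; case: ifPn => [_|n_out]; first exact: primitive_T.
move=> x; apply: primitive_out; move: n_out.
by rewrite negb_and -ltnNge def_m oddS; case: (odd n) (odd p) => [] [].
Qed.

Lemma total_diff_primitive n (x : C n) : (0 < m)%N ->
  cyclic_incl (nu_natural iota phi : C m -> k^o) x - phi x = total_diff primitive x.
Proof.
move=> m_gt0; rewrite /total_diff.
have [eq_mn | neq_mn] := eqVneq m n.
  move: x; rewrite -{n}eq_mn => x; rewrite /cyclic_incl dfwith_in nu_naturalE.
  rewrite -[LHS]opprB phi_sub_pre_nu_Nhat primitive_top //.
  by rewrite [primitive (Bmap x)]primitive_out ?leqnSn // addr0.
rewrite /cyclic_incl dfwith_out // sub0r.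
have [lt_nm | le_mn] := ltnP n m; last first.
  have lt_mn : (m < n)%N by rewrite ltn_neqAle neq_mn.
  rewrite cocycle_out 1?leqNgt ?lt_mn // !primitive_out ?oppr0 ?addr0 ?leqW //.
  by rewrite -ltnS (ltn_predK lt_mn) lt_mn.
have [odd_n | odd_n] := eqVneq (odd n) (odd m).
  by rewrite primitive_bmap // primitive_Bmap // -opprD subrKC.
rewrite cocycle_out ?negb_and ?odd_n ?orbT // oppr0.
rewrite [primitive (Bmap x)]primitive_out; last first.
  by rewrite oddS; case: (odd n) (odd m) odd_n => [] [] //=; rewrite orbT.
rewrite addr0; case: n x lt_nm odd_n {neq_mn} => [|n] x _ odd_n.
  by have [] := T_cochain_raddf (primitive_T 0).
rewrite primitive_out //.
by move: odd_n; rewrite oddS; case: (odd n) (odd m) => [] [] //=; rewrite orbT.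
Qed.

Lemma nu_cyclic_cocycle : cyclic_cocycle (nu_natural iota phi : C m -> k^o).
Proof.
have [fL fT] := T_cochain_comp (pre_nu_T m) (@Nhat_T _ C iota m).
split=> [|y]; last first.
  rewrite nu_naturalE pre_nu_Nhat_b cocycle_b cocycle_out ?oppr0 //.
  by rewrite (ltnNge m.+1) leqnSn.
split=> // x; rewrite !nu_naturalE; apply/eqP; rewrite eq_sym -subr_eq0.
rewrite -pre_nuN -pre_nuD -linearB /= NhatE Nmap_sub_tau pre_nuZ pre_nuD pre_nuN.
by rewrite (pre_nu_T m).2 subrr scaler0.
Qed.

End Cochains.

Theorem corollary12p3 (k : nzRingType) (iota : {rmorphism rat -> k})
    (C : H_unital k) (m : nat) (phi : forall n, C n -> k^o) :
  total_cocycle m phi ->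
  let nu : C m -> k^o := @nu_natural k C iota m phi in
  cyclic_cocycle nu /\ cohomologous m (cyclic_incl nu) phi.
Proof.
move=> phi_cocycle nu; split; first exact: (nu_cyclic_cocycle iota phi_cocycle).
case: m phi_cocycle @nu => [|p] phi_cocycle nu /=.
  (* In degree 0 there is no room for a primitive: nu and phi agree, since N^
     and the correction are the identity on C_0. *)
  move=> n x; case: (eqVneq 0%N n) x => [<- | neq_0n] x; rewrite /cyclic_incl.
    by rewrite dfwith_in /nu nu_naturalE pre_nu0 Nhat0.
  rewrite dfwith_out // (cocycle_out phi_cocycle) // leqn0 eq_sym.
  by rewrite (negPf neq_0n).
exists (primitive iota p.+1 phi); split.
  exact: primitive_cochain.
by move=> n x; apply: total_diff_primitive.
Qed.
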